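(* Let $$J_{\mathrm{TH}}=Z_{N_T}\sum_{j=1}^{N_T}\left(Z_j^{-1}-Z_{j-1}^{-1}\right)J_j .$$ Then $J_{\mathrm{TH}}<J_{\max}$, and for every $J_{\mathrm{ave}}$ with $J_{\mathrm{TH}}\le J_{\mathrm{ave}}\le J_{\max}$ the constrained two-player zero-sum game with payoff matrix $Z$, transmitter strategy set $\mathbf{X}$ and jammer strategy set $\mathbf{Y}_{\mathrm{LE}|J_{\mathrm{ave}}}$ has value at the Nash equilibrium $$Z(\boldsymbol{x}^*,\boldsymbol{y}^* )=Z_{N_T}.$$ Furthermore, for every such $J_{\mathrm{ave}}$, among the jammer's optimal mixed strategies in $\mathbf{Y}_{\mathrm{LE}|J_{\mathrm{ave}}}$ the one with the lowest average power $\boldsymbol{y}^T\boldsymbol{J}$ is $$y_0^*=Z_{N_T}Z_0^{-1},\qquad y_j^*=Z_{N_T}\left(Z_j^{-1}-Z_{j-1}^{-1}\right)\quad(1\le j\le N_T).$$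
   Context: Let $N_T\ge 1$ be an integer. Jamming power levels: real numbers $0=J_0<J_1<\dots<J_{N_T}=J_{\max}$, collected in the column vector $\boldsymbol{J}=(J_0,\dots,J_{N_T})^T$. Payoffs: real numbers $Z_0>Z_1>\dots>Z_{N_T}>0$. The payoff matrix $Z$ is the $(N_T+1)\times(N_T+1)$ lower triangular matrix, indexed by $0\le i,j\le N_T$, with $(i,j)$ entry equal to $Z_i$ if $j\le i$ and $0$ if $j>i$ (the transmitter, using a strategy that withstands jamming power up to $J_i$, receives $Z_i$ if the actual jamming power $J_j$ satisfies $J_j\le J_i$, and $0$ otherwise). The row player (transmitter) maximizes and the column player (jammer) minimizes. $\mathbf{X}=\mathbf{Y}$ is the set of probability vectors in $\mathbb{R}^{N_T+1}$ (entries indexed by $0,\dots,N_T$). For $0\le J_{\mathrm{ave}}\le J_{\max}$, $\mathbf{Y}_{\mathrm{LE}|J_{\mathrm{ave}}}=\{\boldsymbol{y}\in\mathbf{Y}: \boldsymbol{y}^T\boldsymbol{J}\le J_{\mathrm{ave}}\}$. The expected payoff is $Z(\boldsymbol{x},\boldsymbol{y})=\boldsymbol{x}^TZ\boldsymbol{y}$. A Nash equilibrium is a pair $(\boldsymbol{x}^*,\boldsymbol{y}^* )\in\mathbf{X}\times\mathbf{Y}_{\mathrm{LE}|J_{\mathrm{ave}}}$ such that $Z(\boldsymbol{x},\boldsymbol{y}^* )\le Z(\boldsymbol{x}^*,\boldsymbol{y}^* )\le Z(\boldsymbol{x}^*,\boldsymbol{y})$ for all $\boldsymbol{x}\in\mathbf{X}$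 and $\boldsymbol{y}\in\mathbf{Y}_{\mathrm{LE}|J_{\mathrm{ave}}}$; $Z(\boldsymbol{x}^*,\boldsymbol{y}^* )$ is the game value. A jammer strategy $\boldsymbol{y}\in\mathbf{Y}_{\mathrm{LE}|J_{\mathrm{ave}}}$ is optimal if $\max_{\boldsymbol{x}\in\mathbf{X}}Z(\boldsymbol{x},\boldsymbol{y})$ equals the game value (equivalently, it is the jammer's component of some Nash equilibrium). *)

(* Defs.v *)
From mathcomp Require Export all_boot all_order all_algebra.

Set Implicit Arguments.
Unset Strict Implicit.
Unset Printing Implicit Defensive.

Import Order.TTheory GRing.Theory Num.Theory.
Local Open Scope ring_scope.

Section ZeroSumGame.

Variables (R : realFieldType) (S T : Type).
Variables (X : S -> Prop) (Y : T -> Prop) (u : S -> T -> R).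

(* The row player, with strategy set X, maximizes u; the column player, with
   strategy set Y, minimizes it. *)
Definition nash_equilibrium (xs : S) (ys : T) : Prop :=
  [/\ X xs, Y ys,
      forall x, X x -> u x ys <= u xs ys
    & forall y, Y y -> u xs ys <= u xs y].

Definition game_value (v : R) : Prop :=
  exists xs ys, nash_equilibrium xs ys /\ u xs ys = v.

Definition is_maximum (f : S -> R) (m : R) : Prop :=
  (exists2 x, X x & f x = m) /\ (forall x, X x -> f x <= m).

Definition optimal_column (y : T) : Prop :=
  Y y /\ exists2 v, game_value v & is_maximum (fun x => u x y) v.

End ZeroSumGame.

Section Jamming.

Variable R : realFieldType.

Definition prob_vector (n : nat) (x : 'cV[R]_n) : Prop :=
  (forall i, 0 <= x i 0) /\ \sum_i x i 0 = 1.

(* Power levels and payoffs are given by sequences of which only the terms of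
   index 0, ..., N are used. *)
Variables (N : nat) (J Z : nat -> R).

Definition power_vector : 'cV[R]_N.+1 := \col_j J j.

Definition avg_power (y : 'cV[R]_N.+1) : R := (y^T *m power_vector) 0 0.

Definition payoff_matrix : 'M[R]_N.+1 :=
  \matrix_(i, j) if (j <= i)%N then Z i else 0.

Definition payoff (x y : 'cV[R]_N.+1) : R := (x^T *m payoff_matrix *m y) 0 0.

Definition jammer_LE (Jave : R) (y : 'cV[R]_N.+1) : Prop :=
  prob_vector y /\ avg_power y <= Jave.

Definition J_TH : R :=
  Z N * \sum_(1 <= j < N.+1) ((Z j)^-1 - (Z j.-1)^-1) * J j.

Definition y_star : 'cV[R]_N.+1 :=
  \col_j if j == 0%N :> nat then Z N * (Z 0%N)^-1
         else Z N * ((Z j)^-1 - (Z j.-1)^-1).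

End Jamming.

(* Main.v *)
Require Import Defs.
From mathcomp Require Import all_boot all_order all_algebra.

Set Implicit Arguments.
Unset Strict Implicit.
Unset Printing Implicit Defensive.

Import Order.TTheory GRing.Theory Num.Theory.
Local Open Scope ring_scope.

(* Write S_i(y) for the sum of y_j over j <= i.  Pure row i earns Z_i S_i(y)
   against y, and S_i(y_star) = Z_N / Z_i, so y_star makes all rows earn Z_N,
   while row N earns Z_N against every y: the value is Z_N, and y is optimal
   only if S_i(y) <= S_i(y_star) for all i.  Summation by parts writes the
   average power as J_N minus a combination of the S_i(y), i < N, with the
   positive coefficients J_(i+1) - J_i, so y_star minimizes it, strictly. *)

Section CumulativeSums.

Variables (R : realFieldType) (N : nat).
Implicit Types (J Z : nat -> R) (x y : 'cV[R]_N.+1).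

(** The bound is strict, so the empty sum at 0 starts the recursion and $S_i(y)$ is
    [cumsum y i.+1]. *)
Definition cumsum y (m : nat) : R := \sum_(j < N.+1 | (j < m)%N) y j 0.

Lemma cumsum0 y : cumsum y 0 = 0.
Proof. exact: big_pred0. Qed.

Lemma cumsumS y (i : 'I_N.+1) : cumsum y i.+1 = cumsum y i + y i 0.
Proof.
rewrite /cumsum (bigD1 i) //= addrC; congr (_ + _).
by apply: eq_bigl => j; rewrite ltnS [RHS]ltn_neqAle andbC.
Qed.

Lemma cumsum_full y : cumsum y N.+1 = \sum_j y j 0.
Proof. by apply: eq_bigl => j; rewrite ltn_ord. Qed.

Lemma cumsum_inj y y' :
  (forall m, (m <= N)%N -> cumsum y m.+1 = cumsum y' m.+1) -> y = y'.
Proof.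
move=> eq_yy'; apply/colP => i; have := eq_yy' i; rewrite -ltnS !cumsumS.
move/(_ (ltn_ord i)); suff -> : cumsum y i = cumsum y' i by apply: addrI.
case: i => -[|i] lt_iN /=; first by rewrite !cumsum0.
by apply: eq_yy'; rewrite -ltnS ltnW.
Qed.

Lemma payoffE Z x y :
  payoff Z x y = \sum_i x i 0 * (Z i * cumsum y i.+1).
Proof.
rewrite /payoff -mulmxA mxE; apply: eq_bigr => i _; rewrite !mxE.
congr (_ * _); rewrite /cumsum mulr_sumr [RHS]big_mkcond /=.
by apply: eq_bigr => j _; rewrite !mxE ltnS; case: ifP; rewrite ?mul0r.
Qed.

Lemma prob_vector_delta (i : 'I_N.+1) :
  @prob_vector R N.+1 (delta_mx i 0).
Proof.
split=> [j|]; first by rewrite mxE ler0n.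
rewrite (bigD1 i) //= big1 => [|j /negPf ne_ji]; last by rewrite mxE ne_ji.
by rewrite mxE !eqxx addr0.
Qed.

Lemma payoff_delta Z (i : 'I_N.+1) y :
  payoff Z (delta_mx i 0) y = Z i * cumsum y i.+1.
Proof.
rewrite payoffE (bigD1 i) //= big1 => [|j /negPf ne_ji].
  by rewrite mxE !eqxx mul1r addr0.
by rewrite mxE ne_ji mul0r.
Qed.

Lemma avg_powerE J y : avg_power J y = \sum_j y j 0 * J j.
Proof. by rewrite /avg_power mxE; apply: eq_bigr => j _; rewrite !mxE. Qed.

(** Each gap [J N - J j] telescopes into the increments of [J] from [j] to [N]. Exchanging the two
    sums collects the mass at or below [i] in front of the increment at [i], and total mass 1 turns
    the remaining term into [J N]. *)
Lemma avg_power_by_parts J y : prob_vector y ->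
  avg_power J y = J N - \sum_(i < N) cumsum y i.+1 * (J i.+1 - J i).
Proof.
case=> _ y_sum1; rewrite avg_powerE.
have -> : \sum_(i < N) cumsum y i.+1 * (J i.+1 - J i)
          = \sum_(j < N.+1) y j 0 * (J N - J j).
  rewrite -(big_mkord xpredT (fun i => cumsum y i.+1 * (J i.+1 - J i))).
  under eq_bigr do rewrite /cumsum mulr_suml big_mkcond /=.
  rewrite exchange_big; apply: eq_bigr => j _; rewrite -big_mkcond /=.
  have le_jN : (j <= N)%N by rewrite -ltnS.
  rewrite -mulr_sumr -(telescope_sumr J le_jN); congr (_ * _).
  (* Split the range of [i] at [j]: the condition [j < i.+1] fails everywhere below [j] and holds
     everywhere from [j] on. *)
  rewrite (big_cat_nat (leq0n j) le_jN) /= big_nat_cond big_pred0 ?add0r.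
    rewrite big_nat_cond [RHS]big_nat; apply: eq_bigl => i.
    by rewrite ltnS andbAC andbb.
  by move=> i; rewrite ltnS /=; case: leqP => //= _; rewrite andbF.
under [in RHS]eq_bigr do rewrite mulrBr.
by rewrite sumrB -mulr_suml y_sum1 mul1r subKr.
Qed.

End CumulativeSums.

Section EqualizingStrategy.

Variables (R : realFieldType) (N : nat) (J Z : nat -> R).
Hypotheses (J0 : J 0%N = 0)
  (J_incr : forall j : nat, (j < N)%N -> J j < J j.+1)
  (Z_decr : forall j : nat, (j < N)%N -> Z j.+1 < Z j)
  (Z_pos : 0 < Z N).

Local Notation ys := (y_star N Z).

Lemma payoff_gt0 (i : nat) : (i <= N)%N -> 0 < Z i.
Proof.
(* Positivity is assumed only at [N], so the induction is on the distance [N - i]. *)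
move=> le_iN; rewrite -(subKn le_iN); elim: (N - i)%N (leq_subr i N) => [|k IHk].
  by rewrite subn0.
move=> lt_kN; apply: lt_trans (IHk (ltnW lt_kN)) _.
by rewrite -(subnSK lt_kN); apply: Z_decr; rewrite ltn_subrL (leq_trans _ lt_kN).
Qed.

(** The entries of [ys] are the successive differences of [Z N / Z j], so their sum telescopes. *)
Lemma cumsum_y_star (m : nat) : (m <= N)%N -> cumsum ys m.+1 = Z N / Z m.
Proof.
elim: m => [|m IHm] le_mN.
  by rewrite (cumsumS _ (@Ordinal N.+1 0 le_mN)) cumsum0 mxE /= add0r.
rewrite (cumsumS _ (@Ordinal N.+1 m.+1 le_mN)) mxE /= (IHm (ltnW le_mN)).
by rewrite mulrBr subrKC.
Qed.

Lemma prob_vector_y_star : prob_vector ys.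
Proof.
split=> [j|]; last first.
  by rewrite -cumsum_full cumsum_y_star // divff // gt_eqF.
rewrite mxE; case: ifPn => [_|]; last first.
  (* Payoffs decrease, hence their inverses increase. *)
  case: j => -[|j] //= lt_jN _; rewrite mulr_ge0 ?(ltW Z_pos) // subr_ge0.
  by rewrite lef_pV2 ?ltW ?Z_decr // posrE payoff_gt0 // ltnW.
by apply/ltW/divr_gt0 => //; apply: payoff_gt0.
Qed.

Lemma payoff_y_star (x : 'cV[R]_N.+1) : prob_vector x -> payoff Z x ys = Z N.
Proof.
case=> _ x_sum1; rewrite payoffE -[RHS]mul1r -x_sum1 mulr_suml.
apply: eq_bigr => i _; have le_iN : (i <= N)%N by rewrite -ltnS.
by rewrite cumsum_y_star // [Z i * _]mulrC divfK // gt_eqF // payoff_gt0.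
Qed.

Lemma avg_power_y_star : avg_power J ys = J_TH N J Z.
Proof.
(* The exceptional entry at index 0 carries no power, since [J 0] vanishes. *)
rewrite avg_powerE big_ord_recl J0 mulr0 add0r /J_TH big_add1 big_mkord mulr_sumr.
by apply: eq_bigr => j _; rewrite mxE /= mulrA.
Qed.

Lemma J_TH_lt_Jmax : (0 < N)%N -> J_TH N J Z < J N.
Proof.
move=> N_gt0; rewrite -avg_power_y_star avg_power_by_parts; last first.
  exact: prob_vector_y_star.
have term_gt0 (i : 'I_N) : 0 < cumsum ys i.+1 * (J i.+1 - J i).
  have le_iN := ltnW (ltn_ord i).
  by rewrite cumsum_y_star // mulr_gt0 ?subr_gt0 ?J_incr ?divr_gt0 ?payoff_gt0.
(* [0 < N] supplies an index, so the sum of positive terms is not empty. *)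
rewrite ltrBlDr ltrDl (bigD1 (Ordinal N_gt0)) //=.
by apply: ltr_pwDl; [apply: (term_gt0 (Ordinal N_gt0)) | apply: sumr_ge0 => i _; apply: ltW].
Qed.

(** The bound on every pure row is what optimality of [y] provides. If [y] used no more power than
    [ys], a sum of nonnegative terms would be at most 0, so every term would vanish. *)
Lemma avg_power_y_star_lt (y : 'cV[R]_N.+1) : prob_vector y ->
  (forall i, (i <= N)%N -> Z i * cumsum y i.+1 <= Z N) ->
  y != ys -> avg_power J ys < avg_power J y.
Proof.
move=> y_prob y_le; have ys_prob := prob_vector_y_star.
apply: contraNlt; rewrite !avg_power_by_parts // lerD2l lerN2 -subr_le0 -sumrB.
under eq_bigr do rewrite -mulrBl; move=> sum_le0.
have term_ge0 (i : 'I_N) :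
    true -> 0 <= (cumsum ys i.+1 - cumsum y i.+1) * (J i.+1 - J i).
  move=> _; have le_iN := ltnW (ltn_ord i).
  rewrite mulr_ge0 ?subr_ge0 ?(ltW (J_incr _)) // cumsum_y_star //.
  by rewrite ler_pdivlMr ?payoff_gt0 // mulrC y_le.
have sum_eq0 := le_anti (introT andP (conj sum_le0 (sumr_ge0 _ term_ge0))).
(* At [N] both sums are the total mass 1; below [N] the vanishing term has a positive power
   increment as a factor, so the sums agree. *)
apply/eqP/cumsum_inj => m; rewrite leq_eqVlt => /predU1P[->|lt_mN].
  by rewrite !cumsum_full (proj2 y_prob) (proj2 ys_prob).
have /eqP := psumr_eq0P term_ge0 sum_eq0 (i := Ordinal lt_mN) isT.
by rewrite mulf_eq0 !subr_eq0 [_ == J _]gt_eqF ?J_incr // orbF => /eqP.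
Qed.

End EqualizingStrategy.

Theorem theorem4 (R : realFieldType) (NT : nat) (J Z : nat -> R)
  (NT_ge1 : (1 <= NT)%N)
  (J0 : J 0%N = 0)
  (J_incr : forall j : nat, (j < NT)%N -> J j < J j.+1)
  (Z_decr : forall j : nat, (j < NT)%N -> Z j.+1 < Z j)
  (Z_pos : 0 < Z NT) :
  let X := @prob_vector R NT.+1 in
  let Y := @jammer_LE R NT J in
  let u := @payoff R NT Z in
  let ys := y_star NT Z in
  J_TH NT J Z < J NT /\
  (forall Jave : R, J_TH NT J Z <= Jave -> Jave <= J NT ->
    [/\ exists xs ys', nash_equilibrium X (Y Jave) u xs ys',
        forall xs ys', nash_equilibrium X (Y Jave) u xs ys' ->
          u xs ys' = Z NT,
        optimal_column X (Y Jave) u ys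
      & forall y, optimal_column X (Y Jave) u y -> y != ys ->
          avg_power J ys < avg_power J y]).
Proof.
move=> X Y u ys; split; first exact: J_TH_lt_Jmax.
move=> Jave le_TH _.
have X_delta i : X (delta_mx i 0) by apply: prob_vector_delta.
have Y_ys : Y Jave ys.
  by split; [apply: prob_vector_y_star | rewrite avg_power_y_star].
have u_ys x : X x -> u x ys = Z NT by apply: payoff_y_star.
have u_last y : Y Jave y -> u (delta_mx ord_max 0) y = Z NT.
  by case=> -[_ y_sum1] _; rewrite /u payoff_delta cumsum_full y_sum1 mulr1.
have nash_ys : nash_equilibrium X (Y Jave) u (delta_mx ord_max 0) ys.
  by split=> // [x Xx|y Yy]; rewrite [leLHS]u_ys ?u_last.
(* Any equilibrium is squeezed: deviating to [ys] bounds its payoff above by [Z NT], deviating to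
   the last row bounds it below. *)
have value xs ys' : nash_equilibrium X (Y Jave) u xs ys' -> u xs ys' = Z NT.
  case=> Xxs Yys' le_row le_col; apply/le_anti/andP; split.
    by rewrite -(u_ys xs Xxs) le_col.
  by rewrite -(u_last ys' Yys') le_row.
split=> //; first by exists (delta_mx ord_max 0), ys.
  split=> //; exists (Z NT).
    by exists (delta_mx ord_max 0), ys; split=> //; apply: value.
  split; first by exists (delta_mx ord_max 0); rewrite ?u_last.
  by move=> x Xx; rewrite u_ys.
move=> y [[y_prob _] [v [xs [ys' [nash_xs <-]]] [_ y_max]]].
apply: avg_power_y_star_lt => // i le_iN.
(* Testing the maximum at pure row [i] gives the required bound, since the value [v] is that of some
   equilibrium and hence [Z NT]. *)
have := y_max _ (X_delta (inord i)).
by rewrite (value _ _ nash_xs) /u payoff_delta inordK.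
Qed.
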